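(* $N^{\ast}(2)=N_{\ast}(2)=3$ and $N^{\ast}(3)=N_{\ast}(3)=6$. Moreover: (1) If $M=2$, then $\Phi=\begin{bmatrix} a_1 & b_1 & c_1\\ a_2 & b_2 & c_2\end{bmatrix}\in\mathbb{R}^{2\times 3}$ is conjugate phase retrievable on $\mathbb{C}^2$ if and only if $$\det\begin{bmatrix} a_1^2 & 2a_1a_2 & a_2^2\\ b_1^2 & 2b_1b_2 & b_2^2\\ c_1^2 & 2c_1c_2 & c_2^2\end{bmatrix}\neq 0.$$ (2) If $M=3$, then $\Phi=\begin{bmatrix} a_1&b_1&c_1&d_1&e_1&f_1\\ a_2&b_2&c_2&d_2&e_2&f_2\\ a_3&b_3&c_3&d_3&e_3&f_3\end{bmatrix}\in\mathbb{R}^{3\times 6}$ is conjugate phase retrievable on $\mathbb{C}^3$ if and only if $$\det\begin{bmatrix} a_1^2&a_2^2&a_3^2&2a_1a_2&2a_1a_3&2a_2a_3\\ b_1^2&b_2^2&b_3^2&2b_1b_2&2b_1b_3&2b_2b_3\\ c_1^2&c_2^2&c_3^2&2c_1c_2&2c_1c_3&2c_2c_3\\ d_1^2&d_2^2&d_3^2&2d_1d_2&2d_1d_3&2d_2d_3\\ e_1^2&e_2^2&e_3^2&2e_1e_2&2e_1e_3&2e_2e_3\\ f_1^2&f_2^2&f_3^2&2f_1f_2&2f_1f_3&2f_2f_3\end{bmatrix}\neq 0.$$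
   Context: A set of vectors $\{\varphi_n\}_{n=1}^N\subset\mathbb{C}^M$ is conjugate phase retrievable (on $\mathbb{C}^M$) if for all $x,y\in\mathbb{C}^M$: $|\langle x,\varphi_n\rangle|=|\langle y,\varphi_n\rangle|$ for all $n$ implies that there is $\theta\in\mathbb{R}$ with $x=e^{i\theta}y$ or $x=e^{i\theta}\overline{y}$, where $\overline{y}$ is the coordinatewise conjugate. A matrix is identified with the collection of its columns. A frame of $N$ real vectors for $\mathbb{C}^M$ is identified with a full-rank (rank $M$) matrix $\Phi\in\mathbb{R}^{M\times N}$ whose columns are the vectors. ''A generic frame $\Phi\subset\mathbb{R}^{M\times N}$ has property $\mathcal{P}$'' means: the set $Y\subseteq\mathbb{R}^{M\times N}$ of full-rank matrices with property $\mathcal{P}$ is open and dense in $\mathbb{R}^{M\times N}$ (Euclidean topology) and its complement has Lebesgue measure $0$. $N^{\ast}(M)$ is the minimum $N$ such that a generic frame $\Phi\subset\mathbb{R}^{M\times N}$ is conjugate phase retrievable on $\mathbb{C}^M$. $N_{\ast}(M)$ is the minimum $N$ such that there exists a frame $\Phi\in\mathbb{R}^{M\times N}$ that is conjugate phase retrievable on $\mathbb{C}^M$. *)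

(* Defs.v *)
From HB Require Import structures.
From mathcomp Require Import all_boot all_order all_algebra.
From mathcomp Require Import complex.
From mathcomp Require Import all_classical all_reals all_analysis.

Set Implicit Arguments.
Unset Strict Implicit.
Unset Printing Implicit Defensive.

Import Order.TTheory GRing.Theory Num.Theory.
Import numFieldNormedType.Exports.

Local Open Scope classical_set_scope.
Local Open Scope ring_scope.
Local Open Scope complex_scope.

Section LebesgueTuple.
Context {R : realType}.
Local Notation RT := (measurableTypeR R).

Definition cons_pair n (p : RT * n.-tuple RT) : n.+1.-tuple RT :=
  [tuple of p.1 :: p.2].

Definition uncons n (t : n.+1.-tuple RT) : RT * n.-tuple RT :=
  (thead t, [tuple of behead t]).

Lemma cons_pairK n : cancel (@cons_pair n) (@uncons n).
Proof.
by case=> x t; rewrite /uncons /cons_pair /= theadE; congr pair; apply/val_inj.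
Qed.

Lemma measurable_cons_pair n : measurable_fun setT (@cons_pair n).
Proof.
exact: (measurable_cons (@measurable_fst _ _ _ _) (@measurable_snd _ _ _ _)).
Qed.

Lemma measurable_uncons n : measurable_fun setT (@uncons n).
Proof.
apply/measurable_fun_pairP; split; first exact: measurable_tnth.
exact: measurable_behead.
Qed.

Section step.
Variables (n : nat) (mu : {sigma_finite_measure set (n.-tuple RT) -> \bar R}).

Definition lebesgue_cons : set (n.+1.-tuple RT) -> \bar R :=
  pushforward (@lebesgue_measure R \x mu)%E (@cons_pair n).

HB.instance Definition _ := Measure.copy lebesgue_cons
  (measure_function_pushforward__canonical__measure_function_Measure
    (@lebesgue_measure R \x mu)%E (@measurable_cons_pair n)).

Let lebesgue_cons_sigma_finite : sigma_finite setT lebesgue_cons.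
Proof.
have /sigma_finiteP[F [TF ndF Foo]] := sigma_finiteT (@lebesgue_measure R).
have /sigma_finiteP[G [TG ndG Goo]] := sigma_finiteT mu.
exists (fun k => @uncons n @^-1` (F k `*` G k)).
  rewrite -preimage_bigcup (_ : \bigcup_k _ = setT) ?preimage_setT//.
  apply/seteqP; split => // -[x y] _.
  have [j _ Fjx] : (\bigcup_j F j) x by rewrite -TF.
  have [k _ Gky] : (\bigcup_k G k) y by rewrite -TG.
  exists (maxn j k) => //; split => /=.
    by move: x Fjx; exact/subsetPset/ndF/leq_maxl.
  by move: y Gky; exact/subsetPset/ndG/leq_maxr.
move=> k; have [mFk Fk] := Foo k; have [mGk Gk] := Goo k; split.
  rewrite -[X in measurable X]setTI; apply: measurable_uncons => //.
  exact: measurableX.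
rewrite /lebesgue_cons /pushforward -comp_preimage.
rewrite (_ : _ \o _ = id) ?preimage_id; last first.
  by apply/funext => p; exact: cons_pairK.
by rewrite product_measure1E// lte_mul_pinfty// ge0_fin_numE.
Qed.

HB.instance Definition _ := Measure_isSigmaFinite.Build _ _ _ lebesgue_cons
  lebesgue_cons_sigma_finite.

End step.

(* The n-fold product of lebesgue_measure, i.e. Lebesgue measure on R^n; on the
   one-point space R^0 it is the unit mass. *)
Fixpoint lebesgue_tuple n :
    {sigma_finite_measure set (n.-tuple RT) -> \bar R} :=
  match n with
  | 0 => @dirac _ (0.-tuple RT) [tuple] R
  | n'.+1 => lebesgue_cons (lebesgue_tuple n')
  end.

End LebesgueTuple.

Section ConjugatePhaseRetrieval.
Context {R : realType}.

(* M x N matrices are identified with R^(M * N) by listing their entries. *)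
Definition matrix_of_tuple M N (t : (M * N).-tuple (measurableTypeR R)) :
    'M[R]_(M, N) :=
  \matrix_(i, j) tnth t (mxvec_index i j).

Definition lebesgue_null M N (A : set 'M[R]_(M, N)) : Prop :=
  (lebesgue_tuple (M * N)).-negligible (@matrix_of_tuple M N @^-1` A).

Definition inner M (x y : 'cV[R[i]]_M) : R[i] :=
  \sum_(k < M) x k 0 * (y k 0)^*%C.

Definition expi (theta : R) : R[i] := cos theta +i* sin theta.

(* The collection of vectors is given by the columns of Phi. *)
Definition conj_phase_retrievable M N (Phi : 'M[R[i]]_(M, N)) : Prop :=
  forall x y : 'cV[R[i]]_M,
    (forall n : 'I_N, `|inner x (col n Phi)| = `|inner y (col n Phi)|) ->
    exists theta : R,
      x = expi theta *: y \/ x = expi theta *: map_mx conjc y.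

Definition real_conj_phase_retrievable M N (Phi : 'M[R]_(M, N)) : Prop :=
  conj_phase_retrievable (map_mx (real_complex R) Phi).

Definition is_frame M N (Phi : 'M[R]_(M, N)) : Prop := \rank Phi = M.

Definition generic_frame M N (P : 'M[R]_(M, N) -> Prop) : Prop :=
  let Y := [set Phi | is_frame Phi /\ P Phi] in
  [/\ open Y, dense Y & lebesgue_null (~` Y)].

End ConjugatePhaseRetrieval.

Definition is_minimum (S : set nat) (n : nat) : Prop :=
  S n /\ forall m, S m -> (n <= m)%N.

(* n = N^*(M) *)
Definition is_generic_min (R : realType) (M n : nat) : Prop :=
  is_minimum
    [set N | generic_frame (@real_conj_phase_retrievable R M N)] n.

(* n = N_*(M) *)
Definition is_frame_min (R : realType) (M n : nat) : Prop :=
  is_minimum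
    [set N | exists Phi : 'M[R]_(M, N),
       is_frame Phi /\ real_conj_phase_retrievable Phi] n.

(* Main.v *)
Require Import Defs.
From mathcomp Require Import all_boot all_order all_algebra finmap.
From mathcomp Require Import complex ring lra.
From mathcomp Require Import all_classical all_reals all_analysis.
From mathcomp Require Import measurable_realfun.

(** For a real vector v and x = a + i b in C^M one has
      |<x, v>|^2 = (a . v)^2 + (b . v)^2 = v^T G v,
    where G = a a^T + b b^T is the real part of x x^*, called [gram x] below.
    So real measurements see x only through [gram x], and this is exactly the
    ambiguity allowed by conjugate phase retrieval: by [gram_eq], two vectors
    with the same [gram] agree up to a unimodular factor and conjugation.
    Hence Phi is conjugate phase retrievable if and only if no nonzero
    difference S = gram x - gram y satisfies v^T S v = 0 for all columns v of
    Phi.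

    These differences range over symmetric matrices. Conversely, let S be any
    nonzero symmetric matrix annihilated by all columns, and write it as a sum
    of at most M signed squares ([signed_squares]). When M <= 3, either both
    signs occur, each at most twice, and then S is a difference of two Gram
    matrices; or only one sign occurs, and then every vector whose square
    occurs is orthogonal to all columns, so that it is not distinguished from
    0. Thus for M <= 3 retrievability says that the quadratic forms
    S |-> v^T S v, for v a column, separate the symmetric matrices
    ([retrievable_detects], [detects_retrievable]). The matrix of this linear
    system in the M (M + 1) / 2 coordinates of S is the matrix of the theorem;
    this gives the determinant criteria and the lower bounds on N.

    Genericity comes from the fact that the determinant is a polynomial in the
    entries of Phi which does not vanish at the frame of all sums e_i + e_j
    ([pair_sums_detect]). Its nonzero set is open by continuity and dense since
    its restriction to a line is a univariate polynomial with finitely many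
    roots; its zero set is null by Fubini's theorem and induction on the number
    of variables ([iter_poly_null]). *)

Set Implicit Arguments.
Unset Strict Implicit.
Unset Printing Implicit Defensive.

Import Order.TTheory GRing.Theory Num.Theory.
Import numFieldNormedType.Exports.

Local Open Scope ring_scope.

(** * Quadratic forms and sums of signed squares *)

Section QuadraticForms.
Variable (F : realFieldType).

Definition qform M (S : 'M[F]_M) (v : 'cV[F]_M) : F := (v^T *m S *m v) 0 0.

Lemma qformB M (S T : 'M[F]_M) v : qform (S - T) v = qform S v - qform T v.
Proof. by rewrite /qform mulmxBr mulmxBl !mxE. Qed.

Lemma qform_sq M (u v : 'cV[F]_M) : qform (u *m u^T) v = ((u^T *m v) 0 0) ^+ 2.
Proof.
have -> : qform (u *m u^T) v = ((u^T *m v)^T *m (u^T *m v)) 0 0.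
  by rewrite /qform trmx_mul trmxK !mulmxA.
by rewrite mxE big_ord1 mxE expr2.
Qed.

Definition sum_sq M (us : seq 'cV[F]_M) : 'M[F]_M := \sum_(u <- us) u *m u^T.

Lemma qform_sum_sq M (us : seq 'cV[F]_M) v :
  qform (sum_sq us) v = \sum_(u <- us) ((u^T *m v) 0 0) ^+ 2.
Proof.
rewrite /qform /sum_sq mulmx_sumr mulmx_suml summxE.
by apply: eq_bigr => u _; exact: qform_sq.
Qed.

Lemma sum_sq_isotropic M (us : seq 'cV[F]_M) v :
  qform (sum_sq us) v = 0 -> forall u, u \in us -> u^T *m v = 0.
Proof.
rewrite qform_sum_sq => /eqP; rewrite psumr_eq0; last first.
  by move=> u _; exact: sqr_ge0.
move=> /allP us0 u /us0; rewrite /= sqrf_eq0 => /eqP uv0.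
by apply/matrixP => i j; rewrite !ord1 uv0 mxE.
Qed.

Lemma qform_delta_add M (S : 'M[F]_M) i j : S^T = S ->
  qform S (delta_mx i 0 + delta_mx j 0) = S i i + S j j + S i j *+ 2.
Proof.
have E k l :
    ((delta_mx k 0 : 'cV[F]_M)^T *m S *m (delta_mx l 0 : 'cV_M)) 0 0 = S k l.
  by rewrite trmx_delta -rowE -colE !mxE.
move=> Ssym; have Sij : S j i = S i j by rewrite -[in LHS]Ssym mxE.
transitivity (S i i + S j i + (S i j + S j j)); last by rewrite Sij; ring.
by rewrite -!E /qform [_^T]raddfD /= mulmxDl mulmxDr !mulmxDl !mxE.
Qed.

(** Polarization: a symmetric matrix is determined by the values of its form on
    the vectors e_i + e_j. *)
Lemma symmetric_neq0_qform M (S : 'M[F]_M) :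
  S^T = S -> S != 0 -> exists v, qform S v != 0.
Proof.
move=> Ssym; apply: contra_neqP => /forallNP S0; apply/matrixP => i j.
have {}S0 v : qform S v = 0 by apply/eqP/negPn/negP/S0.
have polar k l : S k k + S l l + S k l *+ 2 = 0.
  by rewrite -qform_delta_add ?S0.
have Sd k : S k k = 0 by have := polar k k; lra.
by rewrite mxE; have := polar i j; rewrite !Sd; lra.
Qed.

(** Subtracting this square makes v a new kernel vector while the kernel of S
    stays in the kernel. *)
Lemma rank_deflation M (S : 'M[F]_M) v : S^T = S -> qform S v != 0 ->
  (\rank (S - (qform S v)^-1 *: (S *m v *m (S *m v)^T))%R < \rank S)%N.
Proof.
move=> Ssym Sv; set T := S - _.
have TS : T = (1%:M - (qform S v)^-1 *: (S *m v *m v^T)) *m S.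
  by rewrite /T trmx_mul Ssym mulmxBl mul1mx -scalemxAl !mulmxA.
have vT : v^T *m T = 0.
  rewrite /T mulmxBr -scalemxAr !mulmxA.
  have -> : v^T *m S *m v = (qform S v)%:M by rewrite /qform -mx11_scalar.
  by rewrite mul_scalar_mx scalerA mulVf // scale1r trmx_mul Ssym subrr.
have leTS : (T <= S)%MS by rewrite TS submxMl.
apply: rank_ltmx.
rewrite /ltmx leTS; apply/negP => /submxP[A SA].
have Tsym : T^T = T.
  by rewrite /T linearB /= linearZ /= trmx_mul trmxK Ssym.
move: Sv; rewrite /qform -mulmxA {1}SA -(mulmxA A).
have -> : T *m v = 0 by rewrite -[T]trmxK -[v]trmxK -trmx_mul Tsym vT trmx0.
by rewrite !mulmx0 mxE eqxx.
Qed.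
End QuadraticForms.

Lemma sum_sq_cons (F : realFieldType) M (u : 'cV[F]_M) us :
  sum_sq (u :: us) = u *m u^T + sum_sq us.
Proof. by rewrite /sum_sq big_cons. Qed.

Lemma scale_sq (F : rcfType) M (c : F) (u : 'cV[F]_M) : 0 <= c ->
  c *: (u *m u^T) = (Num.sqrt c *: u) *m (Num.sqrt c *: u)^T.
Proof.
by move=> c0; rewrite linearZ /= -scalemxAl -scalemxAr scalerA -expr2 sqr_sqrtr.
Qed.

(** Lagrange reduction, by induction on the rank: as S is nonzero, some v is not
    isotropic, and [rank_deflation] splits off the square of S v, whose sign is
    that of the form at v. *)
Lemma signed_squares (F : rcfType) M (S : 'M[F]_M) : S^T = S ->
  exists P Q : seq 'cV[F]_M,
    (size P + size Q <= \rank S)%N /\ S = sum_sq P - sum_sq Q.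
Proof.
have [r] := ubnP (\rank S); elim: r S => // r IHr S ltSr Ssym.
have [->|S0] := eqVneq S 0.
  by exists [::], [::]; rewrite /sum_sq !big_nil subrr.
have [v Sv] := symmetric_neq0_qform Ssym S0.
have := rank_deflation Ssym Sv; set T := (S - _)%R => ltTS.
have Tsym : T^T = T.
  by rewrite /T linearB /= linearZ /= trmx_mul trmxK Ssym.
have [P [Q [szPQ TE]]] := IHr T (leq_trans ltTS ltSr) Tsym.
have SE : S = T + (qform S v)^-1 *: (S *m v *m (S *m v)^T) by rewrite subrK.
have [c0|c0] := lerP 0 (qform S v)^-1.
  exists (Num.sqrt (qform S v)^-1 *: (S *m v) :: P), Q; split.
    by rewrite /= addSn (leq_trans _ ltTS).
  by rewrite {1}SE scale_sq // TE sum_sq_cons addrC addrA.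
exists P, (Num.sqrt (- (qform S v)^-1) *: (S *m v) :: Q); split.
  by rewrite /= addnS (leq_trans _ ltTS).
rewrite {1}SE -[X in _ + X]opprK -scaleNr scale_sq ?oppr_ge0 1?ltW //.
rewrite TE sum_sq_cons.
by rewrite opprD addrA addrAC.
Qed.

(** * Recovering a complex vector from its real Gram matrix *)

Section Gram.
Context {R : realType}.
Local Open Scope complex_scope.
Local Notation "z ^*" := (conjc z) : ring_scope.

(** The real part of the rank one matrix x x^*. *)
Definition gram M (x : 'cV[R[i]]_M) : 'M[R]_M :=
  \matrix_(j, k) complex.Re (x j 0 * (x k 0)^*).

Definition cplx M (a b : 'cV[R]_M) : 'cV[R[i]]_M :=
  \col_k (a k 0 +i* b k 0).

Lemma gram_sym M (x : 'cV[R[i]]_M) : (gram x)^T = gram x.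
Proof.
apply/matrixP => j k; rewrite !mxE.
by case: (x j 0) (x k 0) => [a b] [c d] /=; ring.
Qed.

Lemma gram_cplx M (a b : 'cV[R]_M) : gram (cplx a b) = sum_sq [:: a; b].
Proof.
rewrite /sum_sq big_cons big_seq1; apply/matrixP => j k.
rewrite !mxE !big_ord1 !mxE /=; ring.
Qed.

Lemma cplx_Re_Im M (x : 'cV[R[i]]_M) :
  x = cplx (map_mx (@complex.Re R) x) (map_mx (@complex.Im R) x).
Proof. by apply/matrixP => j k; rewrite ord1 !mxE; case: (x j 0). Qed.

Lemma gram0 M : gram (0 : 'cV[R[i]]_M) = 0.
Proof. by apply/matrixP => j k; rewrite !mxE mul0r. Qed.

(** One square for the real part, one for the imaginary part. This bound of two
    is what limits the converse direction to M <= 3. *)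
Lemma sum_sq_gram M (us : seq 'cV[R]_M) : (size us <= 2)%N ->
  exists x : 'cV[R[i]]_M, gram x = sum_sq us.
Proof.
case: us => [|a [|b [|]]] // _.
- by exists 0; rewrite gram0 /sum_sq big_nil.
- by exists (cplx a 0); rewrite gram_cplx /sum_sq !big_cons big_nil mul0mx addr0.
- by exists (cplx a b); exact: gram_cplx.
Qed.

Lemma inner_real M (a b v : 'cV[R]_M) :
  inner (cplx a b) (map_mx (real_complex R) v)
  = ((a^T *m v) 0 0) +i* ((b^T *m v) 0 0).
Proof.
have sumE (f g : 'I_M -> R) :
    \sum_k (f k +i* g k) = (\sum_k f k) +i* (\sum_k g k).
  by elim/big_rec3: _ => // k x y z _ ->.
rewrite /inner !mxE -sumE; apply: eq_bigr => k _.
rewrite !mxE; apply/eqP; rewrite eq_complex /=.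
by apply/andP; split; apply/eqP; ring.
Qed.

Lemma norm_inner_real M (x : 'cV[R[i]]_M) (v : 'cV[R]_M) :
  `|inner x (map_mx (real_complex R) v)| ^+ 2 = (qform (gram x) v)%:C.
Proof.
rewrite [x]cplx_Re_Im inner_real -add_Re2_Im2 /= gram_cplx qform_sum_sq.
by rewrite big_cons big_seq1.
Qed.

Lemma expi_conj (theta : R) : expi theta * (expi theta)^* = 1.
Proof.
rewrite /expi; apply/eqP; rewrite eq_complex /= -(cos2Dsin2 theta) !expr2.
by apply/andP; split; apply/eqP; ring.
Qed.

Lemma unimodular_expi (z : R[i]) : z * z^* = 1 -> exists theta, z = expi theta.
Proof.
case: z => a b /eqP; rewrite eq_complex /= => /andP[/eqP ab _].
have {}ab : a ^+ 2 + b ^+ 2 = 1 by rewrite -ab; ring.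
have a1 : -1 <= a <= 1 by have := sqr_ge0 b; apply: contraLR; nra.
have sina : Num.sqrt (1 - a ^+ 2) = `|b|.
  by rewrite -ab addrC addKr sqrtr_sqr.
have [b0|b0] := lerP 0 b.
  by exists (acos a); rewrite /expi acosK ?in_itv // sin_acos // sina ger0_norm.
exists (- acos a).
by rewrite /expi cosN sinN acosK ?in_itv // sin_acos // sina ltr0_norm // opprK.
Qed.

Lemma ratio_expi (u v : R[i]) : v != 0 -> u * u^* = v * v^* ->
  exists theta, u / v = expi theta.
Proof.
move=> v0 uv; apply: unimodular_expi.
by rewrite rmorphM /= fmorphV /= mulrACA -invfM uv mulfV // mulf_neq0 ?conjc_eq0.
Qed.

Lemma gram_expi M (theta : R) (y : 'cV[R[i]]_M) :
  gram (expi theta *: y) = gram y.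
Proof.
apply/matrixP => j k; rewrite !mxE rmorphM /=.
by rewrite mulrACA expi_conj mul1r.
Qed.

Lemma gram_conj M (y : 'cV[R[i]]_M) : gram (map_mx conjc y) = gram y.
Proof.
apply/matrixP => j k; rewrite !mxE.
by case: (y j 0) (y k 0) => [a b] [c d] /=; ring.
Qed.

(** A real vector is determined up to a global sign by the products of its
    entries. *)
Lemma eq_products_sign (T : Type) (f g : T -> R) :
  (forall j k, f j * f k = g j * g k) ->
  (f =1 g) \/ (forall k, f k = - g k).
Proof.
move=> fg; have [[l gl]|/forallNP g0] := pselect (exists l, g l != 0); last first.
  left=> k; have {}g0 : g k = 0 by apply/eqP/negPn/negP/g0.
  by have /eqP := fg k k; rewrite g0 mul0r mulf_eq0 orbb => /eqP.
have /eqP := fg l l; rewrite -!expr2 eqf_sqr => /orP[] /eqP fl.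
  by left=> k; apply: (mulfI gl); rewrite -(fg l k) fl.
by right=> k; apply: (mulfI gl); rewrite mulrN -(fg l k) fl mulNr opprK.
Qed.

(** Let l be a coordinate with y_l <> 0, and compare the phase-invariant vectors
    p_k = x_k x_l^* and q_k = y_k y_l^*. They have the same real parts, and the
    products Im p_j Im p_k are polynomials in the entries of the Gram matrix, so
    that the imaginary parts agree up to one global sign. According to this
    sign p = q or p = q^*; dividing by x_l^* expresses x by y or by the
    conjugate of y, with a factor of modulus |y_l| / |x_l| = 1. *)
Lemma gram_eq M (x y : 'cV[R[i]]_M) : gram x = gram y ->
  exists theta, x = expi theta *: y \/ x = expi theta *: map_mx conjc y.
Proof.
move=> gxy.
have ReE j k : complex.Re (x j 0 * (x k 0)^*) = complex.Re (y j 0 * (y k 0)^*).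
  by have := congr1 (fun S : 'M[R]_M => S j k) gxy; rewrite !mxE.
have ImJ (z : R[i]) : complex.Im (z * z^*) = 0 by case: z => a b /=; ring.
have nE j : x j 0 * (x j 0)^* = y j 0 * (y j 0)^*.
  by apply/eqP; rewrite eq_complex ReE !ImJ !eqxx.
have [[l yl]|/forallNP y0] := pselect (exists l, y l 0 != 0); last first.
  have {}y0 : y = 0.
    by apply/colP => k; rewrite mxE; apply/eqP/negPn/negP/y0.
  have x0 : x = 0.
    apply/colP => k; have /eqP := nE k.
    by rewrite y0 !mxE mul0r mulf_eq0 conjc_eq0 orbb => /eqP.
  by exists 0; left; rewrite x0 y0 scaler0.
have xl : x l 0 != 0.
  apply: contraNneq yl => xl.
  by have /esym/eqP := nE l; rewrite xl mul0r mulf_eq0 conjc_eq0 orbb.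
pose f (z : 'cV[R[i]]_M) k := complex.Im (z k 0 * (z l 0)^*).
have ff z j k : f z j * f z k =
    complex.Re (z j 0 * (z k 0)^*) * complex.Re (z l 0 * (z l 0)^*)
    - complex.Re (z j 0 * (z l 0)^*) * complex.Re (z k 0 * (z l 0)^*).
  rewrite /f; case: (z j 0) (z k 0) (z l 0) => [a b] [c d] [e h] /=; ring.
have JK (z : R[i]) : (z^*)^* = z by case: z => a b /=; rewrite opprK.
have [fxy|fxy] : (f x =1 f y) \/ (forall k, f x k = - f y k).
  by apply: eq_products_sign => j k; rewrite !ff !ReE.
- have [theta tE] : exists theta, (y l 0)^* / (x l 0)^* = expi theta.
    apply: ratio_expi; first by rewrite conjc_eq0.
    by rewrite !JK ![_^* * _]mulrC nE.
  exists theta; left; apply/colP => k; rewrite mxE -tE mulrAC.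
  apply: (canRL (mulfK _)); first by rewrite conjc_eq0.
  rewrite [_^* * _]mulrC.
  by apply/eqP; rewrite eq_complex ReE -/(f x k) fxy !eqxx.
- have [theta tE] : exists theta, y l 0 / (x l 0)^* = expi theta.
    apply: ratio_expi; first by rewrite conjc_eq0.
    by rewrite JK [_^* * _]mulrC nE.
  exists theta; right; apply/colP => k; rewrite !mxE -tE mulrAC.
  apply: (canRL (mulfK _)); first by rewrite conjc_eq0.
  apply/eqP; rewrite eq_complex ReE -/(f x k) fxy /f.
  apply/andP; case: (y k 0) (y l 0) => [a b] [c d] /=.
  by split; apply/eqP; ring.
Qed.
End Gram.

(** * Retrievability and separation of symmetric matrices *)

Section Retrieval.
Context {R : realType}.

Lemma norm_inner_eq M (x y : 'cV[R[i]]_M) (v : 'cV[R]_M) :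
  `|inner x (map_mx (real_complex R) v)| = `|inner y (map_mx (real_complex R) v)|
  <-> qform (gram x) v = qform (gram y) v.
Proof.
split=> [xy|xy].
  by apply: (@complexI R); rewrite -!norm_inner_real xy.
apply: (pexpIrn (n := 2)); rewrite ?nnegrE //.
by rewrite !norm_inner_real xy.
Qed.

Lemma retrievable_gram M N (Phi : 'M[R]_(M, N)) :
  real_conj_phase_retrievable Phi <->
  forall x y : 'cV[R[i]]_M,
    (forall n, qform (gram x) (col n Phi) = qform (gram y) (col n Phi)) ->
    gram x = gram y.
Proof.
split=> [cprP x y xy|gramP x y xy].
  have [n|theta [->|->]] := cprP x y; first by rewrite -map_col norm_inner_eq.
    by rewrite gram_expi.
  by rewrite gram_expi gram_conj.
by apply/gram_eq/gramP => n; apply/norm_inner_eq; rewrite map_col.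
Qed.

Definition detects_symmetric M N (Phi : 'M[R]_(M, N)) : Prop :=
  forall S : 'M[R]_M, S^T = S -> (forall n, qform S (col n Phi) = 0) -> S = 0.

(** The difference of two Gram matrices with the same measurements is a
    symmetric matrix whose form vanishes at all columns. *)
Lemma detects_retrievable M N (Phi : 'M[R]_(M, N)) :
  detects_symmetric Phi -> real_conj_phase_retrievable Phi.
Proof.
move=> dP; apply/retrievable_gram => x y xy; apply/subr0_eq/dP.
  by rewrite linearB /= !gram_sym.
by move=> n; rewrite qformB xy subrr.
Qed.

(** A real vector orthogonal to all columns has the same measurements as 0. *)
Lemma retrievable_spanning M N (Phi : 'M[R]_(M, N)) (u : 'cV[R]_M) :
  real_conj_phase_retrievable Phi ->
  (forall n, u^T *m col n Phi = 0) -> u *m u^T = 0.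
Proof.
move=> /retrievable_gram cprP uPhi.
have sqE : gram (cplx u 0) = u *m u^T.
  by rewrite gram_cplx /sum_sq !big_cons big_nil mul0mx !addr0.
rewrite -sqE -(gram0 (R := R) M); apply: cprP => n.
by rewrite sqE qform_sq uPhi gram0 /qform mulmx0 mul0mx !mxE expr0n.
Qed.

Lemma definite_retrievable M N (Phi : 'M[R]_(M, N)) (us : seq 'cV[R]_M) :
  real_conj_phase_retrievable Phi ->
  (forall n, qform (sum_sq us) (col n Phi) = 0) -> sum_sq us = 0.
Proof.
move=> cprP us0; rewrite /sum_sq big1_seq // => u /andP[_ uus].
by apply: (retrievable_spanning cprP) => n; apply: sum_sq_isotropic uus.
Qed.

(** At most three signed squares: if both signs occur, neither occurs more than
    twice, and each part is a Gram matrix; otherwise S or - S is a sum of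
    squares and [definite_retrievable] applies. *)
Lemma retrievable_detects M N (Phi : 'M[R]_(M, N)) : (M <= 3)%N ->
  real_conj_phase_retrievable Phi -> detects_symmetric Phi.
Proof.
move=> M3 cprP S Ssym S0.
have [P [Q [szPQ SE]]] := signed_squares Ssym.
have {}szPQ : (size P + size Q <= 3)%N.
  exact: leq_trans szPQ (leq_trans (rank_leq_row S) M3).
have PQ n : qform (sum_sq P) (col n Phi) = qform (sum_sq Q) (col n Phi).
  by apply/eqP; rewrite -subr_eq0 -qformB -SE S0.
have nil0 : sum_sq (@nil 'cV[R]_M) = 0 by rewrite /sum_sq big_nil.
have q0 v : qform 0 v = 0 :> R by rewrite /qform mulmx0 mul0mx mxE.
have [Q0|Q1] := posnP (size Q).
  rewrite SE (size0nil Q0) nil0 subr0; apply: (definite_retrievable cprP) => n.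
  by rewrite PQ (size0nil Q0) nil0 q0.
have [P0|P1] := posnP (size P).
  rewrite SE (size0nil P0) nil0 sub0r (definite_retrievable cprP) ?oppr0 // => n.
  by rewrite -PQ (size0nil P0) nil0 q0.
have [x xP] : exists x : 'cV[R[i]]_M, gram x = sum_sq P.
  by apply: sum_sq_gram; rewrite -ltnS (leq_trans _ szPQ) // -addn1 leq_add2l.
have [y yQ] : exists y : 'cV[R[i]]_M, gram y = sum_sq Q.
  by apply: sum_sq_gram; rewrite -ltnS (leq_trans _ szPQ) // -add1n leq_add2r.
rewrite SE -xP -yQ; apply/eqP; rewrite subr_eq0; apply/eqP.
by move/retrievable_gram : cprP; apply=> n; rewrite xP yQ.
Qed.

(** A row r with r Phi = 0 gives the symmetric matrix r^T r, whose form vanishes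
    at all columns. *)
Lemma detects_frame M N (Phi : 'M[R]_(M, N)) :
  detects_symmetric Phi -> is_frame Phi.
Proof.
move=> dP; apply/eqP; change (row_free Phi); rewrite -kermx_eq0.
apply/eqP/row_matrixP => i; rewrite row0.
set r := row i _; have rPhi : r *m Phi = 0 by rewrite -row_mul mulmx_ker row0.
have rr0 : r^T *m r^T^T = 0.
  apply: dP => [|n]; first by rewrite trmx_mul trmxK.
  by rewrite qform_sq trmxK colE mulmxA rPhi mul0mx mxE expr0n.
apply/rowP => k; have := congr1 (fun S : 'M[R]_M => S k k) rr0.
by rewrite mxE big_ord1 !mxE => /eqP; rewrite mulf_eq0 orbb => /eqP.
Qed.
End Retrieval.

(** * The linear system in coordinates *)

Section Coordinates.
Context {R : realType}.

(** The K coordinates of a symmetric matrix of size M: [pr] enumerates the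
    unordered pairs of indices without repetition, each through one of its
    orderings, and [idx] returns the position of a pair. *)
Definition pair_coding M K (idx : 'I_M -> 'I_M -> 'I_K)
    (pr : 'I_K -> 'I_M * 'I_M) : Prop :=
  [/\ forall k, idx (pr k).1 (pr k).2 = k,
      forall i j, idx i j = idx j i
    & forall i j, pr (idx i j) = (i, j) \/ pr (idx i j) = (j, i)].

Definition sym_mx M K (idx : 'I_M -> 'I_M -> 'I_K) (c : 'cV[R]_K) : 'M[R]_M :=
  \matrix_(i, j) c (idx i j) 0.

(** V is the matrix of S |-> (v_n^T S v_n)_n, for v_n the columns of Phi, in the
    coordinates given by [idx]. *)
Definition evaluates M K N (idx : 'I_M -> 'I_M -> 'I_K)
    (Phi : 'M[R]_(M, N)) (V : 'M[R]_(N, K)) : Prop :=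
  forall c n, (V *m c) n 0 = qform (sym_mx idx c) (col n Phi).

Lemma detects_row_free M K N (idx : 'I_M -> 'I_M -> 'I_K) pr
    (Phi : 'M[R]_(M, N)) (V : 'M[R]_(N, K)) :
  pair_coding idx pr -> evaluates idx Phi V ->
  detects_symmetric Phi <-> row_free V^T.
Proof.
move=> [prK idxC idxK] ev; split=> [dP|/row_freeP[B VB] S Ssym S0].
  rewrite -kermx_eq0; apply/eqP/row_matrixP => i; rewrite row0.
  set r := row i _; have rV : r *m V^T = 0 by rewrite -row_mul mulmx_ker row0.
  have Vr : V *m r^T = 0 by rewrite -[V]trmxK -trmx_mul rV trmx0.
  have s0 : sym_mx idx r^T = 0.
    apply: dP => [|n]; last by rewrite -ev Vr mxE.
    by apply/matrixP => j k; rewrite !mxE idxC.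
  apply/rowP => k.
  have := congr1 (fun S : 'M[R]_M => S (pr k).1 (pr k).2) s0.
  by rewrite !mxE prK.
pose c : 'cV[R]_K := \col_k S (pr k).1 (pr k).2.
have SE : S = sym_mx idx c.
  apply/matrixP => i j; rewrite !mxE.
  by case: (idxK i j) => -> //=; rewrite -[in LHS]Ssym mxE.
have Vc : V *m c = 0.
  by apply/colP => n; rewrite ev -SE S0 mxE.
have c0 : c = 0.
  have BV : B^T *m V = 1%:M by rewrite -[V]trmxK -trmx_mul VB trmx1.
  by rewrite -[c]mul1mx -BV -mulmxA Vc mulmx0.
by rewrite SE c0; apply/matrixP => i j; rewrite !mxE.
Qed.

Lemma detects_leq M K N (idx : 'I_M -> 'I_M -> 'I_K) pr
    (Phi : 'M[R]_(M, N)) (V : 'M[R]_(N, K)) :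
  pair_coding idx pr -> evaluates idx Phi V ->
  detects_symmetric Phi -> (K <= N)%N.
Proof.
move=> co ev /(detects_row_free co ev); rewrite /row_free => /eqP <-.
exact: rank_leq_col.
Qed.

Lemma detects_det M K (idx : 'I_M -> 'I_M -> 'I_K) pr
    (Phi : 'M[R]_(M, K)) (V : 'M[R]_K) :
  pair_coding idx pr -> evaluates idx Phi V ->
  detects_symmetric Phi <-> \det V <> 0.
Proof.
move=> co ev; rewrite (detects_row_free co ev) row_free_unit unitmxE det_tr.
by rewrite unitfE; split => /eqP.
Qed.

(** By polarization the vectors e_i + e_j, i <= j, recover all entries of a
    symmetric matrix; for i = j this is 2 e_i. *)
Lemma pair_sums_detect M K (idx : 'I_M -> 'I_M -> 'I_K) pr :
  pair_coding idx pr ->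
  detects_symmetric
    (\matrix_(i, k) ((i == (pr k).1)%:R + (i == (pr k).2)%:R) : 'M[R]_(M, K)).
Proof.
move=> [_ _ idxK] S Ssym S0.
have qE i j : S i i + S j j + S i j *+ 2 = 0.
  rewrite -qform_delta_add //.
  rewrite -[RHS](S0 (idx i j)); congr qform.
  apply/colP => k; rewrite !mxE !andbT.
  by case: (idxK i j) => -> //=; rewrite addrC.
have Sd i : S i i = 0 by have := qE i i; lra.
by apply/matrixP => i j; rewrite mxE; have := qE i j; rewrite !Sd; lra.
Qed.
End Coordinates.

(** * Zero sets of polynomials are null *)

(** Polynomials in n variables as polynomials in the first variable whose
    coefficients involve the others. This nesting matches the recursion by
    which Lebesgue measure on R^n is built, so that Fubini's theorem can be
    used variable by variable. *)
Fixpoint iter_poly (A : comNzRingType) (n : nat) : comNzRingType :=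
  if n is n'.+1 then {poly iter_poly A n'} else A.

Fixpoint iter_eval (A : comNzRingType) (n : nat) :
    n.-tuple A -> {rmorphism iter_poly A n -> A} :=
  match n with
  | 0 => fun _ => idfun
  | n'.+1 => fun t =>
      horner_eval (thead t) \o map_poly (iter_eval [tuple of behead t])
  end.

Fixpoint iter_var (A : comNzRingType) (n : nat) : 'I_n -> iter_poly A n :=
  match n with
  | 0 => fun _ => 0
  | n'.+1 => fun i =>
      if unlift ord0 i is Some j then (iter_var A j)%:P else 'X
  end.

Lemma iter_evalS (A : comNzRingType) n (p : iter_poly A n.+1)
    (t : n.+1.-tuple A) :
  iter_eval t p
  = (map_poly (iter_eval [tuple of behead t]) (p : {poly _})).[thead t].
Proof. by []. Qed.

Lemma iter_eval_var (A : comNzRingType) n (t : n.-tuple A) (i : 'I_n) :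
  iter_eval t (iter_var A i) = tnth t i.
Proof.
elim: n t i => [|n IHn] t i; first by case: i.
rewrite iter_evalS /=; case: unliftP => [j ->|->].
  rewrite map_polyC hornerC [LHS]IHn tnth_behead.
  by congr (tnth t _); apply/val_inj; rewrite /= inordK // /bump ltnS.
by rewrite map_polyX hornerX /thead.
Qed.

(** A class of functions that is closed under the ring operations contains every
    polynomial expression in its members; it serves both for continuity and for
    measurability. *)
Lemma iter_eval_ind (A : comNzRingType) (T : Type) (P : (T -> A) -> Prop)
    (P_cst : forall a, P (fun=> a))
    (P_add : forall f g, P f -> P g -> P (fun x => f x + g x))
    (P_mul : forall f g, P f -> P g -> P (fun x => f x * g x))
    n (p : iter_poly A n) (t : T -> n.-tuple A) :
  (forall i, P (fun x => tnth (t x) i)) -> P (fun x => iter_eval (t x) p).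
Proof.
elim: n p t => [|n IHn] p t Pt; first exact: P_cst.
have Pbehead (a : iter_poly A n) :
    P (fun x => iter_eval [tuple of behead (t x)] a).
  apply: (IHn a (fun x => [tuple of behead (t x)])) => i.
  rewrite (_ : (fun _ => _) = fun x => tnth (t x) (inord i.+1)).
    exact: Pt.
  by apply/funext => x; rewrite tnth_behead.
elim/poly_ind: p => [|p a IHp].
  rewrite (_ : (fun _ => _) = fun=> 0); first exact: P_cst.
  by apply/funext => x; rewrite rmorph0.
rewrite (_ : (fun _ => _) =
  fun x => iter_eval (t x) p * thead (t x)
           + iter_eval [tuple of behead (t x)] a).
  by apply: P_add => //; apply: P_mul => //; exact: Pt.
apply/funext => x; rewrite !iter_evalS.
by rewrite rmorphD rmorphM /= map_polyX map_polyC hornerMXaddC.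
Qed.

Section Measure.
Context {R : realType}.
Local Notation RT := (measurableTypeR R).
Local Open Scope classical_set_scope.

Lemma measurable_iter_eval n (p : iter_poly R n) :
  measurable_fun setT (fun t : n.-tuple RT => (iter_eval t p : RT)).
Proof.
apply: (@iter_eval_ind R (n.-tuple RT) (measurable_fun setT)) => //.
- by move=> f g mf mg; exact: measurable_funD.
- by move=> f g mf mg; exact: measurable_funM.
- by move=> i; exact: measurable_tnth.
Qed.

Lemma finite_roots (p : {poly R}) : p != 0 -> finite_set [set x | p.[x] = 0].
Proof.
move=> p0; apply: contrapT => /(infinite_set_fset (size p))[/= F Fp szF].
have : (size (enum_fset F) < size p)%N.
  apply: (max_poly_roots p0); last exact: fset_uniq.
  by apply/allP => x /Fp px; apply/rootP.
by rewrite ltnNge szF.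
Qed.

(** By induction, the leading coefficient in the first variable is nonzero for
    almost all values of the other variables. For these values the section of
    the zero set is the set of roots of a nonzero univariate polynomial, hence
    finite, and Fubini's theorem concludes. *)
Lemma iter_poly_null n (p : iter_poly R n) : p != 0 ->
  (lebesgue_tuple n) [set t : n.-tuple RT | iter_eval t p = 0] = 0%E.
Proof.
elim: n p => [|n IHn] p p0.
  rewrite (_ : [set t | _] = set0) ?measure0 //.
  by apply/seteqP; split=> // t /= pt; rewrite pt eqxx in p0.
have mZ k (q : iter_poly R k) :
    measurable [set t : k.-tuple RT | iter_eval t q = 0].
  rewrite -[X in measurable X]setTI.
  exact: (measurable_iter_eval q _ (measurable_set1 _)).
set Z := [set t | _].
have mcZ : measurable (@cons_pair R n @^-1` Z).
  rewrite -[X in measurable X]setTI.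
  exact: (measurable_cons_pair measurableT (mZ _ p)).
rewrite /= /lebesgue_cons /pushforward.
(* The first variable has to be integrated first. *)
rewrite (product_measure_unique
  (m' := (@lebesgue_measure R \x^ lebesgue_tuple n)%E)) //; last first.
  by move=> A B mA mB; exact: product_measure2E.
rewrite -[LHS]/(\int[lebesgue_tuple n]_t
  (@lebesgue_measure R \o ysection (@cons_pair R n @^-1` Z)) t)%E.
pose c : iter_poly R n := lead_coef (p : {poly _}).
have c0 : c != 0 by rewrite lead_coef_eq0.
rewrite (ge0_ae_eq_integral (g := cst 0%E)) ?integral0 //.
- exact: measurable_fun_ysection.
- exists [set t : n.-tuple RT | iter_eval t c = 0]; split; first exact: mZ.
    exact: IHn.
  move=> t /= /not_implyP[_]; apply: contra_notP => ct /=.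
  apply: countable_lebesgue_measure0; apply: finite_set_countable.
  have q0 : map_poly (iter_eval t) (p : {poly _}) != 0.
    apply/eqP => /(congr1 (fun q : {poly R} => q`_(size (p : {poly _})).-1)).
    by rewrite coef_map coef0.
  apply: sub_finite_set (finite_roots q0) => x.
  rewrite /ysection /= inE /Z /= => <-.
  rewrite /horner_eval /=; congr (map_poly (iter_eval _) _).[_].
  exact/val_inj.
Qed.
End Measure.

(** * Nonvanishing of a polynomial is a generic condition *)

(** A function of matrices that is defined over every commutative ring and
    commutes with ring morphisms is a polynomial with integer coefficients in
    the entries: its value at the matrix of variables is that polynomial.
    Applied to {poly R} it gives the restriction of the polynomial to a line. *)
Section Generic.
Context {R : realType} (M N : nat).
Variable D : forall A : comNzRingType, 'M[A]_(M, N) -> A.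
Hypothesis D_nat : forall (A B : comNzRingType) (f : {rmorphism A -> B}) Phi,
  f (D Phi) = D (map_mx f Phi).
Local Open Scope classical_set_scope.

Definition univ_mx : 'M[iter_poly R (M * N)]_(M, N) :=
  \matrix_(i, j) iter_var R (mxvec_index i j).

Lemma iter_eval_univ (t : (M * N).-tuple R) :
  iter_eval t (D univ_mx) = D (matrix_of_tuple t).
Proof.
rewrite D_nat; congr D; apply/matrixP => i j.
by rewrite !mxE iter_eval_var.
Qed.

Lemma natural_continuous : continuous (@D R).
Proof.
pose tup (Phi : 'M[R]_(M, N)) := [tuple mxvec Phi 0 k | k < M * N].
rewrite (_ : @D R = fun Phi => iter_eval (tup Phi) (D univ_mx)).
  apply: (@iter_eval_ind R 'M[R]_(M, N) (fun f => continuous (f : _ -> R))) => /=.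
  - by move=> a; exact: cst_continuous.
  - by move=> f g cf cg x; exact: (@continuousD _ _ _ f g x (cf x) (cg x)).
  - by move=> f g cf cg x; exact: (continuousM (cf x) (cg x)).
  - move=> k; case/mxvec_indexP: k => i j.
    rewrite (_ : (fun _ => _) = fun Phi : 'M[R]_(M, N) => Phi i j).
      exact: coord_continuous.
    by apply/funext => Phi; rewrite tnth_mktuple mxvecE.
apply/funext => Phi; rewrite iter_eval_univ; congr D.
by apply/matrixP => i j; rewrite mxE tnth_mktuple mxvecE.
Qed.

(** On the line from Phi to Phi0 the polynomial is not identically zero, as it
    does not vanish at Phi0; so points that are not roots exist in every
    neighbourhood of Phi. *)
Lemma natural_dense (Phi0 : 'M[R]_(M, N)) :
  D Phi0 != 0 -> dense [set Phi : 'M[R]_(M, N) | D Phi != 0].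
Proof.
move=> D0 O [Phi OPhi] oO.
pose line (s : R) := Phi + s *: (Phi0 - Phi).
pose p : {poly R} := D (map_mx polyC Phi + 'X *: map_mx polyC (Phi0 - Phi)).
have pE s : p.[s] = D (line s).
  rewrite -[LHS]/(horner_eval s p) D_nat; congr D; apply/matrixP => i j.
  by rewrite !mxE rmorphD rmorphM /= /horner_eval !hornerC hornerX.
have p0 : p != 0.
  apply: contraNneq D0 => p0.
  by rewrite -(_ : line 1 = Phi0) -?pE ?p0 ?horner0 // /line scale1r subrKC.
have cline : {for 0, continuous line}.
  apply: continuousD; first exact: cst_continuous.
  by apply: continuousZr_tmp; exact: cvg_id.
have : nbhs (0 : R) (line @^-1` O).
  apply: cline; apply: open_nbhs_nbhs; split => //.
  by rewrite /line scale0r addr0.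
move=> /nbhs_ballP[e /= e0 eO].
have [s [es ps]] : exists s, ball (0 : R) e s /\ p.[s] != 0.
  apply: contrapT => /forallNP noroot.
  have fin : finite_set (ball (0 : R) e).
    apply: sub_finite_set (finite_roots p0) => s es /=.
    by apply/eqP; apply: contrapT => /negP ps; apply: (noroot s).
  (* A ball is not countable, having positive measure. *)
  have := countable_lebesgue_measure0 (finite_set_countable fin).
  rewrite lebesgue_measure_ball ?(ltW e0) // => -[] /eqP.
  by rewrite mulrn_eq0 /= gt_eqF.
exists (line s); split; first exact: eO.
by rewrite /= -pE.
Qed.

Lemma natural_null (Phi0 : 'M[R]_(M, N)) :
  D Phi0 != 0 -> lebesgue_null [set Phi : 'M[R]_(M, N) | D Phi = 0].
Proof.
move=> D0.
have univ0 : D univ_mx != 0.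
  apply: contraNneq D0 => u0.
  have := iter_eval_univ [tuple mxvec Phi0 0 k | k < M * N].
  rewrite u0 rmorph0 => ->; apply/eqP; congr D.
  by apply/matrixP => i j; rewrite mxE tnth_mktuple mxvecE.
exists [set t | iter_eval t (D univ_mx) = 0]; split.
- rewrite -[X in measurable X]setTI.
  exact: (measurable_iter_eval _ _ (measurable_set1 _)).
- exact: iter_poly_null.
- by move=> t /= Dt; rewrite iter_eval_univ.
Qed.

Lemma natural_generic_frame (P : 'M[R]_(M, N) -> Prop) (Phi0 : 'M[R]_(M, N)) :
  (forall Phi, is_frame Phi /\ P Phi <-> D Phi <> 0) -> D Phi0 <> 0 ->
  generic_frame P.
Proof.
move=> PD /eqP D0; rewrite /generic_frame.
have -> : [set Phi | is_frame Phi /\ P Phi] = [set Phi | D Phi != 0].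
  apply/seteqP; split => Phi /=; first by move=> /PD /eqP.
  by move=> /eqP /PD.
split; last 1 first.
- have -> : ~` [set Phi | D Phi != 0] = [set Phi : 'M[R]_(M, N) | D Phi = 0].
    apply/seteqP; split => Phi /=; first by move=> /negP/negPn/eqP.
    by move=> ->; rewrite eqxx.
  exact: natural_null D0.
- apply: (open_comp (f := @D R) _ (@open_neq R 0)) => Phi _.
  exact: natural_continuous.
- exact: natural_dense D0.
Qed.
End Generic.

(** * Dimensions two and three *)

(** The matrix V Phi of the linear system may have any shape N x K, which gives
    the lower bound K on the number of vectors: fewer than K equations cannot
    separate the symmetric matrices. For N = K its determinant is natural in
    the ring and nonzero at the frame of sums e_i + e_j. *)
Lemma minimal_frame_size (R : realType) M K (idx : 'I_M -> 'I_M -> 'I_K) pr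
    (V : forall (A : comNzRingType) N, 'M[A]_(M, N) -> 'M[A]_(N, K)) :
  (M <= 3)%N -> pair_coding idx pr ->
  (forall N (Phi : 'M[R]_(M, N)), evaluates idx Phi (V R N Phi)) ->
  (forall (A B : comNzRingType) (f : {rmorphism A -> B}) N (Phi : 'M[A]_(M, N)),
    map_mx f (V A N Phi) = V B N (map_mx f Phi)) ->
  [/\ is_generic_min R M K, is_frame_min R M K
    & forall Phi : 'M[R]_(M, K),
        real_conj_phase_retrievable Phi <-> \det (V R K Phi) <> 0].
Proof.
move=> M3 co ev V_nat.
have cprE N (Phi : 'M[R]_(M, N)) :
    real_conj_phase_retrievable Phi <-> detects_symmetric Phi.
  by split; [exact: retrievable_detects|exact: detects_retrievable].
have detE (Phi : 'M[R]_(M, K)) :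
    detects_symmetric Phi <-> \det (V R K Phi) <> 0.
  exact: (detects_det co (ev _ _)).
have lower N (Phi : 'M[R]_(M, N)) :
    real_conj_phase_retrievable Phi -> (K <= N)%N.
  by move=> /cprE; exact: detects_leq co (ev _ _).
have dP0 := pair_sums_detect co (R := R).
split; last by move=> Phi; rewrite cprE.
- split=> /= [|N [_ dense_Y _]].
    apply: (natural_generic_frame (D := fun A Phi => \det (V A K Phi))).
    + by move=> A B f Phi; rewrite -V_nat det_map_mx.
    + move=> Phi; rewrite cprE -detE; split=> [[]|dP] //.
      by split=> //; exact: detects_frame.
    + by apply/detE; exact: dP0.
  have [Phi [_ [_ cprP]]] := dense_Y setT (ex_intro _ 0 I) openT.
  exact: lower cprP.
- split=> /= [|N [Phi [_ cprP]]]; last exact: lower cprP.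
  by eexists; split; [exact: detects_frame dP0|apply/cprE; exact: dP0].
Qed.

Definition quad_mx2 (A : comNzRingType) N (Phi : 'M[A]_(2, N)) : 'M[A]_(N, 3) :=
  \matrix_(n < N, k < 3)
    [:: Phi 0 n ^+ 2; 2 * Phi 0 n * Phi 1 n; Phi 1 n ^+ 2]`_k.

Definition quad_mx3 (A : comNzRingType) N (Phi : 'M[A]_(3, N)) : 'M[A]_(N, 6) :=
  \matrix_(n < N, k < 6)
    [:: Phi 0 n ^+ 2; Phi 1 n ^+ 2; Phi 2 n ^+ 2;
        2 * Phi 0 n * Phi 1 n; 2 * Phi 0 n * Phi 2 n;
        2 * Phi 1 n * Phi 2 n]`_k.

(** With this choice, i + j is the position of the pair (i, j) in the order
    (0,0), (0,1), (1,1). *)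
Definition idx2 (i j : 'I_2) : 'I_3 := inord (i + j).
Definition pr2 (k : 'I_3) : 'I_2 * 'I_2 :=
  nth (0, 0) [:: (0, 0); (0, 1); (1, 1)] k.

(** The squares come first; then the products x_i x_j, i <> j, are ordered by
    i + j, which starts at 1, whence the shift by 2. *)
Definition idx3 (i j : 'I_3) : 'I_6 :=
  inord (if i == j then i : nat else i + j + 2)%N.
Definition pr3 (k : 'I_6) : 'I_3 * 'I_3 :=
  nth (0, 0) [:: (0, 0); (1, 1); (2, 2); (0, 1); (0, 2); (1, 2)] k.

Lemma ord2E (i : 'I_2) : i = 0 \/ i = 1.
Proof. by case: i => [[|[|]]] // i2; [left|right]; exact/val_inj. Qed.

Lemma ord3E (i : 'I_3) : [\/ i = 0, i = 1 | i = 2].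
Proof.
case: i => [[|[|[|]]]] // i3; [apply: Or31|apply: Or32|apply: Or33];
  exact/val_inj.
Qed.

Lemma pair_coding2 : pair_coding idx2 pr2.
Proof.
split=> [k|i j|i j].
- by case: k => [[|[|[|]]]] // k3; apply/val_inj; rewrite /= inordK.
- by rewrite /idx2 addnC.
- by case: (ord2E i) (ord2E j) => -> [] ->; rewrite /pr2 /= inordK /=; auto.
Qed.

Lemma pair_coding3 : pair_coding idx3 pr3.
Proof.
split=> [k|i j|i j].
- by case: k => [[|[|[|[|[|[|]]]]]]] // k6; apply/val_inj; rewrite /= inordK.
- by rewrite /idx3 eq_sym (addnC i); case: eqP => [->|].
- by case: (ord3E i) (ord3E j) => -> [] ->; rewrite /pr3 /= inordK /=; auto.
Qed.

Lemma quad_mx2_map (A B : comNzRingType) (f : {rmorphism A -> B}) N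
    (Phi : 'M[A]_(2, N)) : map_mx f (quad_mx2 Phi) = quad_mx2 (map_mx f Phi).
Proof.
apply/matrixP => n [[|[|[|]]]] // k3; rewrite !mxE /=;
  by rewrite !(rmorphXn, rmorphM, rmorph_nat).
Qed.

Lemma quad_mx3_map (A B : comNzRingType) (f : {rmorphism A -> B}) N
    (Phi : 'M[A]_(3, N)) : map_mx f (quad_mx3 Phi) = quad_mx3 (map_mx f Phi).
Proof.
apply/matrixP => n [[|[|[|[|[|[|]]]]]]] // k6; rewrite !mxE /=;
  by rewrite !(rmorphXn, rmorphM, rmorph_nat).
Qed.

Lemma qformE (R : realFieldType) M (S : 'M[R]_M) (v : 'cV[R]_M) :
  qform S v = \sum_i \sum_j S i j * v i 0 * v j 0.
Proof.
rewrite /qform -mulmxA mxE; apply: eq_bigr => i _.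
rewrite !mxE mulr_sumr; apply: eq_bigr => j _.
by ring.
Qed.

Lemma mulmx_colE (R : nzRingType) N K (V : 'M[R]_(N, K.+1)) (c : 'cV[R]_K.+1) n :
  (V *m c) n 0 = \sum_(0 <= k < K.+1) V n (inord k) * c (inord k) 0.
Proof.
by rewrite mxE big_mkord; apply: eq_bigr => k _; rewrite inord_val.
Qed.

Lemma quad_mx2_evaluates (R : realType) N (Phi : 'M[R]_(2, N)) :
  evaluates idx2 Phi (quad_mx2 Phi).
Proof.
move=> c n.
have sum2 (F : 'I_2 -> R) : \sum_i F i = F 0 + F 1.
  by rewrite big_ord_recl big_ord1; congr (_ + F _); exact/val_inj.
rewrite mulmx_colE unlock /= qformE !sum2 !mxE !inordK // /idx2 /=.
move: (c (inord 0) 0) (c (inord 1) 0) (c (inord 2) 0) => c0 c1 c2.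
by move: (Phi 0 n) (Phi 1 n) => x y; ring.
Qed.

Lemma quad_mx3_evaluates (R : realType) N (Phi : 'M[R]_(3, N)) :
  evaluates idx3 Phi (quad_mx3 Phi).
Proof.
move=> c n.
have sum3 (F : 'I_3 -> R) : \sum_i F i = F 0 + F 1 + F 2.
  rewrite !big_ord_recl big_ord0 addr0 addrA.
  by congr (_ + F _ + F _); exact/val_inj.
rewrite mulmx_colE unlock /= qformE !sum3 !mxE !inordK // /idx3 /=.
move: (c (inord 0) 0) (c (inord 1) 0) (c (inord 2) 0) => c0 c1 c2.
move: (c (inord 3) 0) (c (inord 4) 0) (c (inord 5) 0) => c3 c4 c5.
by move: (Phi 0 n) (Phi 1 n) (Phi 2 n) => x y z; ring.
Qed.

Theorem theorem2p4 (R : realType) :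
  [/\ is_generic_min R 2 3 /\ is_frame_min R 2 3,
      is_generic_min R 3 6 /\ is_frame_min R 3 6,
      forall Phi : 'M[R]_(2, 3),
        real_conj_phase_retrievable Phi <->
        \det (\matrix_(n < 3, k < 3)
          [:: Phi 0 n ^+ 2; 2 * Phi 0 n * Phi 1 n; Phi 1 n ^+ 2]`_k) <> 0
    & forall Phi : 'M[R]_(3, 6),
        real_conj_phase_retrievable Phi <->
        \det (\matrix_(n < 6, k < 6)
          [:: Phi 0 n ^+ 2; Phi 1 n ^+ 2; Phi 2 n ^+ 2;
              2 * Phi 0 n * Phi 1 n; 2 * Phi 0 n * Phi 2 n;
              2 * Phi 1 n * Phi 2 n]`_k) <> 0].
Proof.
have [gen2 frame2 det2] := minimal_frame_size (R := R) (V := quad_mx2) isT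
  pair_coding2 (@quad_mx2_evaluates R) quad_mx2_map.
have [gen3 frame3 det3] := minimal_frame_size (R := R) (V := quad_mx3) isT
  pair_coding3 (@quad_mx3_evaluates R) quad_mx3_map.
by split.
Qed.
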